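(* Let $(\Omega,\mathcal{A},\mu)$ be a $\sigma$-finite measure space and let $X$ be a solid Banach function space on $\Omega$. Put $\mathcal{A}_0:=\{E\in\mathcal{A}:\ \mu(E)>0 \text{ and } \chi_E\in X\}$ and $\mathcal{A}_\infty:=\{E\in\mathcal{A}:\ \chi_E\in X\}$. Assume that $\inf\{\|\chi_E\|_X:\ E\in\mathcal{A}_0\}=0$ and $\sup\{\|\chi_E\|_X:\ E\in\mathcal{A}_\infty\}<\infty$. Then for each real $p\geq 1$, the set $X^p\setminus\bigcup_{q>p}X^q$ (the union being over all real $q>p$) is spaceable in $X^p$.
   Context: $\mathcal{M}_0(\Omega)$ denotes the set of all $\mathcal{A}$-measurable complex-valued functions on $\Omega$, with functions that are equal $\mu$-almost everywhere identified. A linear subspace $X$ of $\mathcal{M}_0(\Omega)$ equipped with a norm $\|\cdot\|_X$ is called a Banach function space on $\Omega$ if $(X,\|\cdot\|_X)$ is a Banach space. It is called solid if for each $f\in X$ and $g\in\mathcal{M}_0(\Omega)$ with $|g|\leq|f|$ a.e. we have $g\in X$ and $\|g\|_X\leq\|f\|_X$. $\chi_E$ is the characteristic function of $E$. For $p\geq1$ and $f\in\mathcal{M}_0(\Omega)$ put $\|f\|_p:=\inf\{\lambda>0:\ (|f|/\lambda)^p\in X,\ \|(|f|/\lambda)^p\|_X\leq 1\}$ (with $\inf\varnothing=\infty$); $X^p$ is the set of all $f\in\mathcal{M}_0(\Omega)$ with $\|f\|_p<\infty$, and $(X^p,\|\cdot\|_p)$ is a Banach function space on $\Omega$. (Thus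 $f\in X^p$ iff $|f|^p\in X$, and then $\|f\|_p=\||f|^p\|_X^{1/p}$.) A subset $S$ of a Banach space $Y$ is called spaceable in $Y$ if $S\cup\{0\}$ contains a closed infinite-dimensional linear subspace of $Y$. *)

(* Defs.v *)
From HB Require Import structures.
From mathcomp Require Import all_boot all_order all_algebra generic_quotient.
From mathcomp Require Import complex.
From mathcomp Require Import all_classical all_reals all_analysis.

From mathcomp Require Import measurable_realfun.
Set Implicit Arguments.
Unset Strict Implicit.
Unset Printing Implicit Defensive.

Import Order.TTheory GRing.Theory Num.Theory.
Import numFieldNormedType.Exports.
Import ComplexField.Normc.

Local Open Scope classical_set_scope.
Local Open Scope ring_scope.
Local Open Scope complex_scope.
Local Open Scope quotient_scope.

(* The sigma-algebra of C is that of R * R, pulled back along (Re, Im); the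
   latter is the Borel sigma-algebra of the plane. *)
Section complex_measurable.
Variable R : realType.

Definition ReIm (z : R[i]) : R * R := (complex.Re z, complex.Im z).

HB.instance Definition _ := isPointed.Build R[i] 0.
HB.instance Definition _ :=
  Measurable.copy R[i] (g_sigma_algebra_preimageType ReIm).

Context d (T : measurableType d).

Lemma measurable_fun_complexP (f : T -> R[i]) :
  measurable_fun setT f <->
  measurable_fun setT (@complex.Re R \o f) /\ measurable_fun setT (@complex.Im R \o f).
Proof.
split=> [mf|].
  apply/(measurable_fun_pairP (ReIm \o f)) => _ B mB.
  rewrite setTI; have := mf measurableT (ReIm @^-1` B); rewrite setTI; apply.
  by exists B => //; rewrite setTI.
move=> /(measurable_fun_pairP (ReIm \o f)) mf _ A [B mB <-].
by rewrite (setTI (ReIm @^-1` B)); exact: (mf measurableT B mB).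
Qed.

Lemma measurable_normc (f : T -> R[i]) :
  measurable_fun setT f -> measurable_fun setT (fun x => normc (f x)).
Proof.
move=> /measurable_fun_complexP[mRe mIm].
have -> : (fun x => normc (f x)) =
    Num.sqrt \o (fun x => complex.Re (f x) ^+ 2 + complex.Im (f x) ^+ 2).
  by apply/funext => x /=; case: (f x).
apply: measurableT_comp.
  by apply: continuous_measurable_fun; exact: sqrt_continuous.
by apply: measurable_funD; apply: measurable_funX; [exact: mRe|exact: mIm].
Qed.

Lemma measurable_real_complex (f : T -> R) :
  measurable_fun setT f -> measurable_fun setT (fun x => (f x)%:C : R[i]).
Proof.
move=> mf; apply/measurable_fun_complexP; split; first exact: mf.
exact: measurable_cst.
Qed.

Implicit Types f g : {mfun T >-> R[i]}.

Fact mfun_add_subproof f g : (fun x => f x + g x) \in @mfun _ _ T R[i].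
Proof.
have /measurable_fun_complexP[fR fI] : measurable_fun setT f by [].
have /measurable_fun_complexP[gR gI] : measurable_fun setT g by [].
rewrite inE/=; apply/measurable_fun_complexP; split.
- rewrite (_ : _ \o _ = (@complex.Re R \o f) \+ (@complex.Re R \o g)).
    exact: measurable_funD.
  by apply/funext => x /=; case: (f x) (g x) => [? ?] [].
- rewrite (_ : _ \o _ = (@complex.Im R \o f) \+ (@complex.Im R \o g)).
    exact: measurable_funD.
  by apply/funext => x /=; case: (f x) (g x) => [? ?] [].
Qed.
Definition mfun_add f g : {mfun T >-> R[i]} := mfun_Sub (mfun_add_subproof f g).

Fact mfun_scale_subproof (a : R[i]) f :
  (fun x => a * f x) \in @mfun _ _ T R[i].
Proof.
have /measurable_fun_complexP[fR fI] : measurable_fun setT f by [].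
rewrite inE/=; apply/measurable_fun_complexP; case: a => a b; split.
- rewrite (_ : _ \o _ =
    (fun x => a * (@complex.Re R \o f) x - b * (@complex.Im R \o f) x)).
    by apply: measurable_funB; exact: measurable_funM.
  by apply/funext => x /=; case: (f x).
- rewrite (_ : _ \o _ =
    (fun x => a * (@complex.Im R \o f) x + b * (@complex.Re R \o f) x)).
    by apply: measurable_funD; exact: measurable_funM.
  by apply/funext => x /=; case: (f x).
Qed.
Definition mfun_scale (a : R[i]) f : {mfun T >-> R[i]} :=
  mfun_Sub (mfun_scale_subproof a f).

End complex_measurable.

Section M0.
Context d (T : measurableType d) (R : realType).
Variable mu : {measure set T -> \bar R}.

Definition M0 : Type := {mfun_ mu, T >-> R[i]}.
Identity Coercion M0_to_aeEqMfun : M0 >-> aeEqMfun.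

HB.instance Definition _ := Choice.on M0.
HB.instance Definition _ := EqQuotient.on M0.

Implicit Types (f g h : {mfun T >-> R[i]}) (u v w : M0).

Lemma piM0_eq f g : (\pi_M0 f = \pi_M0 g) <-> (f = g %[ae mu]).
Proof.
split=> [/eqP|fg]; first by rewrite eqmodE => /asboolP.
by apply/eqP; rewrite eqmodE; apply/asboolP.
Qed.

Lemma reprM0 f : (repr (\pi_M0 f) : T -> R[i]) = f %[ae mu].
Proof. by apply/piM0_eq; rewrite reprK. Qed.

Lemma M0_surj u : exists f, u = \pi_M0 f.
Proof. by exists (repr u); rewrite reprK. Qed.

Definition zeroM0 : M0 := \pi_M0 (cst 0).
Definition addM0 u v : M0 := \pi_M0 (mfun_add (repr u) (repr v)).
Definition scaleM0 (a : R[i]) u : M0 := \pi_M0 (mfun_scale a (repr u)).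
Definition oppM0 u : M0 := scaleM0 (-1) u.

Lemma piM0D f g : addM0 (\pi_M0 f) (\pi_M0 g) = \pi_M0 (mfun_add f g).
Proof.
apply/piM0_eq; move: (reprM0 f) (reprM0 g); apply: filterS2 => x + + _.
by move=> /(_ I) fx /(_ I) gx; rewrite /= fx gx.
Qed.

Lemma piM0Z a f : scaleM0 a (\pi_M0 f) = \pi_M0 (mfun_scale a f).
Proof.
apply/piM0_eq; move: (reprM0 f); apply: filterS => x + _.
by move=> /(_ I) fx; rewrite /= fx.
Qed.

Fact addM0A : associative addM0.
Proof.
move=> u v w; have [[f ->] [g ->] [h ->]] := And3 (M0_surj u) (M0_surj v) (M0_surj w).
rewrite !piM0D.
by congr (\pi_M0 _); apply/mfuneqP => x /=; rewrite addrA.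
Qed.
Fact addM0C : commutative addM0.
Proof.
move=> u v; have [[f ->] [g ->]] := (M0_surj u, M0_surj v).
rewrite !piM0D.
by congr (\pi_M0 _); apply/mfuneqP => x /=; rewrite addrC.
Qed.
Fact add0M0 : left_id zeroM0 addM0.
Proof.
move=> u; have [f ->] := M0_surj u; rewrite piM0D.
by congr (\pi_M0 _); apply/mfuneqP => x /=; rewrite add0r.
Qed.
Fact addNM0 : left_inverse zeroM0 oppM0 addM0.
Proof.
move=> u; have [f ->] := M0_surj u; rewrite /oppM0 piM0Z piM0D.
by congr (\pi_M0 _); apply/mfuneqP => x /=; rewrite mulN1r addNr.
Qed.
HB.instance Definition _ :=
  GRing.isZmodule.Build M0 addM0A addM0C add0M0 addNM0.

Fact scaleM0A a b u : scaleM0 a (scaleM0 b u) = scaleM0 (a * b) u.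
Proof.
have [f ->] := M0_surj u; rewrite !piM0Z.
by congr (\pi_M0 _); apply/mfuneqP => x /=; rewrite mulrA.
Qed.
Fact scale1M0 : left_id 1 scaleM0.
Proof.
move=> u; have [f ->] := M0_surj u; rewrite piM0Z.
by congr (\pi_M0 _); apply/mfuneqP => x /=; rewrite mul1r.
Qed.
Fact scaleM0Dr : right_distributive scaleM0 addM0.
Proof.
move=> a u v; have [[f ->] [g ->]] := (M0_surj u, M0_surj v).
rewrite !(piM0D, piM0Z).
by congr (\pi_M0 _); apply/mfuneqP => x /=; rewrite mulrDr.
Qed.
Fact scaleM0Dl u a b : scaleM0 (a + b) u = addM0 (scaleM0 a u) (scaleM0 b u).
Proof.
have [f ->] := M0_surj u; rewrite !(piM0D, piM0Z).
by congr (\pi_M0 _); apply/mfuneqP => x /=; rewrite mulrDl.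
Qed.
HB.instance Definition _ := GRing.Zmodule_isLmodule.Build R[i] M0
  scaleM0A scale1M0 scaleM0Dr scaleM0Dl.

(* Measurable sets are bundled with their measurability so that chi is a total
   function into M0. *)
Fact chi_subproof (E : {E : set T | measurable E}) :
  (fun x => (\1_(sval E) x)%:C : R[i]) \in @mfun _ _ T R[i].
Proof.
by rewrite inE/=; apply: measurable_real_complex; exact/measurable_indic/(svalP E).
Qed.
Definition chi (E : {E : set T | measurable E}) : M0 :=
  \pi_M0 (mfun_Sub (chi_subproof E)).

Fact abspow_subproof (l p : R) (f : M0) :
  (fun x => ((normc (f x) / l) `^ p)%:C : R[i]) \in @mfun _ _ T R[i].
Proof.
rewrite inE/=; apply: measurable_real_complex.
apply: (measurableT_comp (measurable_powR p)).
apply: measurable_funM => //; apply: measurable_normc; exact: measurable_funPT.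
Qed.
(* abspow l p f is (|f| / l)^p. *)
Definition abspow (l p : R) (f : M0) : M0 :=
  \pi_M0 (mfun_Sub (abspow_subproof l p f)).

End M0.

Section function_spaces.
Context d (T : measurableType d) (R : realType).
Variable mu : {measure set T -> \bar R}.
Local Notation M0 := (M0 mu).
Local Notation chi := (chi mu).
Implicit Types f g : M0.

(* A set of classes of functions with a norm; the values of fnorm outside
   fcarrier are irrelevant. *)
Record normed_fspace := NormedFspace {
  fcarrier : set M0 ;
  fnorm : M0 -> R }.

Definition banach_function_space (X : normed_fspace) : Prop :=
  [/\ submod_closed (mem (fcarrier X)),
      [/\ forall f, fcarrier X f -> 0 <= fnorm X f,
          forall f, fcarrier X f -> fnorm X f = 0 -> f = 0,
          forall (a : R[i]) f, fcarrier X f ->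
            fnorm X (a *: f) = normc a * fnorm X f &
          forall f g, fcarrier X f -> fcarrier X g ->
            fnorm X (f + g) <= fnorm X f + fnorm X g] &
      forall u : nat -> M0, (forall n, fcarrier X (u n)) ->
        (forall e : R, 0 < e -> exists N : nat, forall m n : nat,
          (N <= m)%N -> (N <= n)%N -> fnorm X (u m - u n) < e) ->
        exists2 f, fcarrier X f & fnorm X (u n - f) @[n --> \oo] --> (0 : R)].

Definition solid (X : normed_fspace) : Prop :=
  forall f g : M0, fcarrier X f ->
    {ae mu, forall x, normc (g x) <= normc (f x)} ->
    fcarrier X g /\ fnorm X g <= fnorm X f.

Definition A_infty (X : normed_fspace) : set {E : set T | measurable E} :=
  [set E | fcarrier X (chi E)].

Definition A_zero (X : normed_fspace) : set {E : set T | measurable E} :=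
  [set E | (0 < mu (sval E))%E /\ fcarrier X (chi E)].

(* The infimum is taken in \bar R, where the empty set has infimum +oo. *)
Definition Xpow_norm (X : normed_fspace) (p : R) (f : M0) : \bar R :=
  ereal_inf [set l%:E | l in [set l : R | [/\ 0 < l,
    fcarrier X (abspow l p f) & fnorm X (abspow l p f) <= 1]]].

Definition Xpow (X : normed_fspace) (p : R) : normed_fspace :=
  NormedFspace [set f | (Xpow_norm X p f < +oo)%E]
               (fun f => fine (Xpow_norm X p f)).

Definition closed_in (Y : normed_fspace) (V : set M0) : Prop :=
  forall f, fcarrier Y f ->
    (forall e : R, 0 < e -> exists2 g, V g & fnorm Y (f - g) < e) -> V f.

Definition finite_dimensional (V : set M0) : Prop :=
  exists (n : nat) (b : 'I_n -> M0), (forall i, V (b i)) /\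
    forall f, V f -> exists c : 'I_n -> R[i], f = \sum_(i < n) c i *: b i.

Definition spaceable (S : set M0) (Y : normed_fspace) : Prop :=
  exists V : set M0,
    [/\ V `<=` fcarrier Y, submod_closed (mem V), closed_in Y V,
        ~ finite_dimensional V & V `<=` S `|` [set 0]].

End function_spaces.

(* Main.v *)
(* The hypothesis on [inf ||chi_E||] yields disjoint sets D_n whose norms
   d_n = ||chi_{D_n}|| are positive and at most 2^(-n^2 - n).  The
   function h equal to (2^n d_n)^(-1/p) on D_n then lies in X^p, while
   ||chi_{D_n} h^q|| is unbounded in n for every q > p, even along any infinite
   set of indices.  Split the indices into infinitely many infinite classes and
   partition T accordingly into sets T_j, with h_j the restriction of h to T_j:
   the functions f of X^p whose restriction to each T_j is a multiple of h_j
   form a closed subspace, it contains the independent h_j, and a nonzero f in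
   it satisfies |f| >= |c| |h_j| with c <> 0 for some j, hence lies in no X^q. *)
Require Import Defs.
From HB Require Import structures.
From mathcomp Require Import all_boot all_order all_algebra generic_quotient.
From mathcomp Require Import complex.
From mathcomp Require Import all_classical all_reals all_analysis.
From mathcomp Require Import measurable_realfun lra.

Set Implicit Arguments.
Unset Strict Implicit.
Unset Printing Implicit Defensive.

Import Order.TTheory GRing.Theory Num.Theory.
Import numFieldNormedType.Exports.
Import ComplexField.Normc.
Local Open Scope classical_set_scope.
Local Open Scope ring_scope.
Local Open Scope complex_scope.
Local Open Scope quotient_scope.

(** * The real-valued modulus on the complex numbers *)

Section normc_extra.
Context {R : realType}.
Implicit Types (x y : R[i]) (r : R).

Lemma normc_ge0 x : 0 <= normc x.
Proof. by case: x => a b; exact: sqrtr_ge0. Qed.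

Lemma normc_real r : normc (r%:C : R[i]) = `|r|.
Proof. by rewrite /= expr0n/= addr0 sqrtr_sqr. Qed.

Lemma normc_Re x : `|complex.Re x| <= normc x.
Proof. by have := normc_ge_Re x; rewrite normc_def lecR; case: x. Qed.

Lemma normc_Im x : `|complex.Im x| <= normc x.
Proof.
by case: x => a b /=; rewrite -sqrtr_sqr ler_wsqrtr// lerDr sqr_ge0.
Qed.

Lemma normc_le_ReIm x : normc x <= `|complex.Re x| + `|complex.Im x|.
Proof.
case: x => a b; rewrite -[leRHS]ger0_norm ?addr_ge0//= -[leRHS]sqrtr_sqr.
rewrite ler_wsqrtr// sqrrD !real_normK ?num_real//.
by rewrite lerD2r lerDl mulrn_wge0// mulr_ge0.
Qed.

(** The modulus dominates the absolute values of both parts and is at most their sum, so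
    completeness passes componentwise from [R] to [R[i]]. *)
Lemma normc_cauchy_cvg (c : nat -> R[i]) :
  (forall e, 0 < e -> exists N, forall m n, (N <= m)%N -> (N <= n)%N ->
    normc (c m - c n) < e) ->
  exists l, normc (c n - l) @[n --> \oo] --> (0 : R).
Proof.
move=> cc.
have H (f : {additive R[i] -> R}) : (forall x, `|f x| <= normc x) ->
    exists l, `|f (c n) - l| @[n --> \oo] --> (0 : R).
  move=> fle.
  have /cauchy_cvgP/cvg_ex[l fl] : cauchy (f (c n) @[n --> \oo]).
    apply/cauchy_exP => e e0; have [N cN] := cc e e0.
    exists (f (c N)) => //=; exists N => // n /= Nn; rewrite /ball/=.
    by rewrite -raddfB (le_lt_trans (fle _))// cN.
  exists l; apply/norm_cvg0P/cvgr0Pnorm_lt => e e0.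
  by have /cvgrPdist_lt/(_ _ e0) := fl; apply: filterS => n; rewrite distrC.
have [a ca] := H (@complex.Re R) normc_Re.
have [b cb] := H (@complex.Im R) normc_Im.
exists (Complex a b); apply: (@squeeze_cvgr _ _ _ _ (cst 0)
   (fun n => `|complex.Re (c n) - a| + `|complex.Im (c n) - b|)).
- apply: nearW => n; rewrite normc_ge0/= (le_trans (normc_le_ReIm _))//.
  by case: (c n).
- exact: cvg_cst.
- by rewrite -[0]addr0; exact: cvgD.
Qed.

End normc_extra.

(** * Almost everywhere pointwise description of the operations on [M0] *)

Section M0_theory.
Context d (T : measurableType d) (R : realType).
Variable mu : {measure set T -> \bar R}.
Local Notation M0 := (M0 mu).
Implicit Types (u v w : M0) (f g : T -> R[i]).

Lemma M0P u v : u = v <-> {ae mu, forall x, u x = v x}.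
Proof.
rewrite -{1}(reprK u) -{1}(reprK v) piM0_eq; split.
  by apply: filterS => x /(_ I).
by apply: filterS => x ? _.
Qed.

Lemma M0D u v : {ae mu, forall x, (u + v : M0) x = u x + v x}.
Proof.
rewrite [u + v]/(addM0 u v) /addM0.
by move: (reprM0 mu (mfun_add (repr u) (repr v))); apply: filterS => x /(_ I).
Qed.

Lemma M0Z a u : {ae mu, forall x, (a *: u : M0) x = a * u x}.
Proof.
rewrite [a *: u]/(scaleM0 a u) /scaleM0.
by move: (reprM0 mu (mfun_scale a (repr u))); apply: filterS => x /(_ I).
Qed.

Lemma M0B u v : {ae mu, forall x, (u - v : M0) x = u x - v x}.
Proof.
rewrite -scaleN1r; move: (M0D u (-1 *: v)) (M0Z (-1) v).
by apply: filterS2 => x -> ->; rewrite mulN1r.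
Qed.

Lemma M00 : {ae mu, forall x, (0 : M0) x = 0}.
Proof. by move: (reprM0 mu (cst 0)); apply: filterS => x /(_ I). Qed.

Lemma M0_measurable u : measurable_fun setT u.
Proof. exact: measurable_funPT. Qed.

(* The class of [f]; the junk value is [0] when [f] is not measurable. *)
Definition toM0 (f : T -> R[i]) : M0 :=
  if pselect (measurable_fun setT f) is left mf
  then \pi_M0 (mfun_Sub (mem_set mf)) else 0.

Lemma toM0E f : measurable_fun setT f -> {ae mu, forall x, toM0 f x = f x}.
Proof.
rewrite /toM0; case: pselect => // mf _.
by move: (reprM0 mu (mfun_Sub (mem_set mf))); apply: filterS => x /(_ I).
Qed.

Lemma chiE (E : {E : set T | measurable E}) :
  {ae mu, forall x, chi mu E x = (\1_(sval E) x)%:C}.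
Proof.
by move: (reprM0 mu (mfun_Sub (chi_subproof R E))); apply: filterS => x /(_ I).
Qed.

Lemma abspowE l p u :
  {ae mu, forall x, abspow l p u x = ((normc (u x) / l) `^ p)%:C}.
Proof.
move: (reprM0 mu (mfun_Sub (abspow_subproof l p u))).
by apply: filterS => x /(_ I).
Qed.

End M0_theory.

(** * Norm rules and domination of geometric series in a solid Banach function space *)

Section solid_banach.
Context d (T : measurableType d) (R : realType).
Variable mu : {measure set T -> \bar R}.
Variable X : normed_fspace mu.
Hypothesis X_banach : banach_function_space X.
Hypothesis X_solid : solid X.
Local Notation M0 := (M0 mu).
Local Notation "u \inX" := (fcarrier X u) (at level 70).
Local Notation N := (fnorm X).
Implicit Types (u v w : M0).

Lemma carrier0 : 0 \inX.
Proof. by have [[/set_mem]] := X_banach. Qed.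

Lemma carrierZD a u v : u \inX -> v \inX -> (a *: u + v) \inX.
Proof.
by move=> uX vX; have [[_ /(_ a u v)]] := X_banach; rewrite !inE => /(_ uX vX).
Qed.

Lemma carrierZ a u : u \inX -> (a *: u) \inX.
Proof.
by move=> uX; rewrite -[a *: u]addr0; apply: carrierZD => //; exact: carrier0.
Qed.

Lemma carrierD u v : u \inX -> v \inX -> (u + v) \inX.
Proof. by move=> uX vX; rewrite -[u]scale1r; exact: carrierZD. Qed.

Lemma carrierB u v : u \inX -> v \inX -> (u - v) \inX.
Proof. by move=> uX vX; rewrite -scaleN1r; exact/carrierD/carrierZ. Qed.

Lemma fnorm_ge0 u : u \inX -> 0 <= N u.
Proof. by have [_ []] := X_banach; auto. Qed.

Lemma fnorm_eq0 u : u \inX -> N u = 0 -> u = 0.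
Proof. by have [_ []] := X_banach; auto. Qed.

Lemma fnormZ a u : u \inX -> N (a *: u) = normc a * N u.
Proof. by have [_ []] := X_banach; auto. Qed.

Lemma fnorm0 : N 0 = 0.
Proof. by rewrite -(scale0r 0) fnormZ ?normc0 ?mul0r//; exact: carrier0. Qed.

Lemma fnormD u v : u \inX -> v \inX -> N (u + v) <= N u + N v.
Proof. by have [_ []] := X_banach; auto. Qed.

Lemma fnormBC u v : u \inX -> v \inX -> N (u - v) = N (v - u).
Proof.
move=> uX vX; rewrite -opprB -scaleN1r fnormZ ?normcN ?normc1 ?mul1r//.
exact: carrierB.
Qed.

Lemma fnorm_gt0 u : u \inX -> u != 0 -> 0 < N u.
Proof.
move=> uX u0; rewrite lt_neqAle fnorm_ge0// andbT eq_sym.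
by apply: contra_neq u0; exact: fnorm_eq0.
Qed.

(* The limit of the partial sums of the moduli dominates each of them, because
   the positive part of [|u n| - |F|] is at most [|S M - F|] for [n < M]. *)
Lemma geometric_dominated (u : nat -> M0) (C : R) :
  (forall n, u n \inX) -> (forall n, N (u n) <= C / 2 ^+ n) ->
  exists F : M0, [/\ F \inX, N F <= 2 * C &
    forall n, {ae mu, forall x, normc (u n x) <= normc (F x)}].
Proof.
move=> uX uC.
have C0 : 0 <= C.
  by have := le_trans (fnorm_ge0 (uX 0)) (uC 0); rewrite expr0 divr1.
pose v n := toM0 mu (fun x => (normc (u n x))%:C).
have vE n : {ae mu, forall x, v n x = (normc (u n x))%:C}.
  by apply/toM0E/measurable_real_complex/measurable_normc/M0_measurable.
have vXN n : v n \inX /\ N (v n) <= C / 2 ^+ n.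
  have [//|vX vN] := X_solid (uX n) (g := v n).
    by move: (vE n); apply: filterS => x ->; rewrite normc_real ger0_norm ?normc_ge0.
  by split => //; exact: le_trans vN (uC n).
pose S M : M0 := \sum_(k < M) v k.
have SX M : S M \inX.
  rewrite /S; elim: M => [|M IH]; first by rewrite big_ord0; exact: carrier0.
  by rewrite big_ord_recr/=; apply: carrierD => //; exact: (vXN M).1.
(* The bound is a difference so that the induction telescopes: [v (m + k)] costs at most
   [C / 2 ^+ (m + k)], which is exactly how much [2 * C / 2 ^+ (m + k)] drops when the exponent
   grows by one. *)
have SN m k : N (S (m + k)%N - S m) <= 2 * C / 2 ^+ m - 2 * C / 2 ^+ (m + k).
  elim: k => [|k IH]; first by rewrite addn0 !subrr fnorm0.
  rewrite addnS {1}/S big_ord_recr/= -/(S (m + k)%N) addrAC.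
  apply: le_trans (fnormD (carrierB (SX _) (SX _)) (vXN _).1) _.
  apply: le_trans (lerD IH (vXN _).2) _.
  by rewrite exprS -mulf_div divff ?pnatr_eq0// mul1r
    -(mulrA 2 C (2 ^+ (m + k))^-1); lra.
have SN' m n : (m <= n)%N -> N (S n - S m) <= 2 * C / 2 ^+ m.
  move=> mn; rewrite -(subnKC mn); apply: le_trans (SN _ _) _.
  by rewrite lerBlDr lerDl !mulr_ge0 ?invr_ge0 ?exprn_ge0.
have geo0 : 2 * C / 2 ^+ n @[n --> \oo] --> (0 : R).
  rewrite -[0](mulr0 (2 * C)); apply: cvgMr.
  have := @cvg_geometric _ 1 (2^-1 : R); rewrite ger0_norm// invf_lt1// ltr1n.
  move=> /(_ isT); rewrite /geometric/=; under eq_fun do rewrite mul1r exprVn.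
  exact.
have [F FX SF] : exists2 F, F \inX & N (S n - F) @[n --> \oo] --> (0 : R).
  have [_ _ ] := X_banach; apply => // e e0.
  have /cvgrPdist_lt/(_ _ e0)[K _ geoK] := geo0.
  have geoK' m : (K <= m)%N -> 2 * C / 2 ^+ m < e.
    by move/geoK => /=; rewrite sub0r normrN; apply: le_lt_trans; exact: ler_norm.
  exists K => m n Km Kn; have [mn|/ltnW nm] := leqP m n.
    rewrite fnormBC//; apply: le_lt_trans (SN' _ _ mn) (geoK' _ Km).
  exact: le_lt_trans (SN' _ _ nm) (geoK' _ Kn).
exists F; split => //.
  rewrite -[leRHS]addr0; apply/ler_addgt0Pr => e e0.
  have /cvgrPdist_lt/(_ _ e0)[K _ /(_ _ (leqnn K))/=] := SF.
  rewrite sub0r normrN ger0_norm ?fnorm_ge0//; last exact: carrierB.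
  (* [S 0] is the empty sum, so [SN'] at 0 bounds the norm of [S K] itself by [2 * C]. *)
  move=> SKF; have := SN' 0 K (leq0n _); rewrite {2}/S big_ord0 subr0 expr0 divr1.
  move=> SK2; rewrite addr0 -[F](subrK (S K)) addrC.
  apply: le_trans (fnormD (SX _) (carrierB FX (SX _))) _.
  by apply: lerD => //; rewrite fnormBC// ltW.
move=> n.
have SE M : {ae mu, forall x, S M x = (\sum_(k < M) normc (u k x))%:C}.
  elim: M => [|M IH]; rewrite /S.
    by rewrite big_ord0; move: (M00 mu); apply: filterS => x ->; rewrite big_ord0.
  rewrite big_ord_recr/=.
  have := M0D (S M) (v M); move: IH (vE M); apply: filterS3 => x.
  by move=> SMx vMx ->; rewrite SMx vMx big_ord_recr/= raddfD.
have mnF : measurable_fun setT (fun x => normc (F x)).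
  exact/measurable_normc/M0_measurable.
have mnu : measurable_fun setT (fun x => normc (u n x)).
  exact/measurable_normc/M0_measurable.
pose g := toM0 mu (fun x => (Num.max 0 (normc (u n x) - normc (F x)))%:C).
have gE : {ae mu, forall x, g x = (Num.max 0 (normc (u n x) - normc (F x)))%:C}.
  apply/toM0E/measurable_real_complex/measurable_maxr => //.
  exact: measurable_funB.
have gS M : (n < M)%N -> g \inX /\ N g <= N (S M - F).
  move=> nM; apply: X_solid; first exact: carrierB.
  have := M0B (S M) F; move: gE (SE M); apply: filterS3 => x -> SMx ->.
  rewrite normc_real ger0_norm ?le_max ?lexx// ge_max normc_ge0/=.
  rewrite lerBlDr; apply: (@le_trans _ _ (normc (S M x))).
    rewrite SMx normc_real ger0_norm ?sumr_ge0// => [|i _]; last exact: normc_ge0.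
    rewrite (bigD1 (Ordinal nM))//= lerDl sumr_ge0// => i _; exact: normc_ge0.
  by rewrite -{1}[S M x](subrK (F x)) le_normcD.
have g0 : g = 0.
  have gX := (gS n.+1 (ltnSn n)).1; apply: fnorm_eq0 => //.
  apply/eqP; rewrite eq_le fnorm_ge0// andbT; apply/ler_addgt0Pr => e e0.
  rewrite add0r; have /cvgrPdist_lt/(_ _ e0)[K _ SK] := SF.
  have /SK/= := leq_maxl K n.+1.
  rewrite sub0r normrN ger0_norm ?fnorm_ge0//; last exact: carrierB.
  by move=> /ltW; apply: le_trans; apply: (gS _ _).2; rewrite leq_max ltnSn orbT.
have := M00 mu; rewrite -g0; move: gE; apply: filterS2 => x -> [] /eqP.
by rewrite eq_maxl subr_le0.
Qed.

End solid_banach.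

(** * Disjoint sets of small positive norm *)

Section small_disjoint_sets.
Context d (T : measurableType d) (R : realType).
Variable mu : {measure set T -> \bar R}.
Variable X : normed_fspace mu.
Hypothesis X_banach : banach_function_space X.
Hypothesis X_solid : solid X.
Hypothesis inf_A_zero :
  ereal_inf [set (fnorm X (chi mu E))%:E | E in A_zero X] = 0%E.
Local Notation M0 := (M0 mu).
Local Notation "u \inX" := (fcarrier X u) (at level 70).
Local Notation N := (fnorm X).

(** Defined on all sets, unlike [chi], so that no measurability proof has to be carried along;
    [ind_chi] identifies the two. *)
Definition ind (A : set T) : M0 := toM0 mu (fun x => (\1_A x)%:C).

Lemma indE A : measurable A -> {ae mu, forall x, ind A x = (\1_A x)%:C}.
Proof. by move=> mA; apply/toM0E/measurable_real_complex/measurable_indic. Qed.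

Lemma ind_chi A (mA : measurable A) : ind A = chi mu (exist _ A mA).
Proof.
by apply/M0P; move: (indE mA) (chiE mu (exist _ A mA)); apply: filterS2 => x -> ->.
Qed.

Lemma ind_neq0 A : measurable A -> (0 < mu A)%E -> ind A != 0.
Proof.
move=> mA; apply: contraTneq => A0; rewrite -leNgt.
have : mu.-negligible A.
  have : {ae mu, forall x, ~ A x}.
    have := M00 mu; rewrite -A0; move: (indE mA); apply: filterS2 => x -> [] + Ax.
    by rewrite indicE mem_set// => /eqP; rewrite oner_eq0.
  by apply: negligibleS => x Ax /(_ Ax).
by move/(measure_negligible mA) => ->.
Qed.

Lemma normc_indic (A : set T) x : normc (((\1_A x)%:C : R[i])) = \1_A x.
Proof. by rewrite normc_real ger0_norm. Qed.

(** A set of positive measure has a nonzero class, which is why the small norm is still positive. *)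
Lemma exists_small_set (e : R) : 0 < e -> exists A : set T,
  [/\ measurable A, ind A \inX, 0 < N (ind A) & N (ind A) < e].
Proof.
move=> e0.
have [|_ [[A mA] [/= A0 AX] <-] Ae] := @ereal_inf_lt R
    [set (N (chi mu E))%:E | E in A_zero X] e%:E.
  by rewrite inf_A_zero lte_fin.
exists A; rewrite (ind_chi mA); split => //.
by apply: (fnorm_gt0 X_banach) => //; rewrite -ind_chi; exact: ind_neq0.
Qed.

(** Recursive choice below the minimum of [s n] and a quarter of the previous norm; the previous
    norm being positive keeps the recursion going. *)
Lemma exists_fast_sets (s : nat -> R) : (forall n, 0 < s n) ->
  exists E : nat -> set T, [/\ forall n, measurable (E n),
    forall n, ind (E n) \inX,
    forall n, 0 < N (ind (E n)),
    forall n, N (ind (E n)) <= s n &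
    forall n, N (ind (E n.+1)) <= N (ind (E n)) / 4].
Proof.
move=> s0.
(* The condition [0 < e] sits inside the choice, with [set0] as default value, so that [G] is total
   and can be iterated. *)
have /choice[G GP] (e : R) : exists A, 0 < e ->
    [/\ measurable A, ind A \inX, 0 < N (ind A) & N (ind A) < e].
  by have [/exists_small_set[A ?]|_] := ltP 0 e; [exists A|exists set0].
pose fix E n := if n is m.+1 then G (Num.min (N (ind (E m)) / 4) (s n))
                else G (s 0).
have EP n : [/\ measurable (E n), ind (E n) \inX, 0 < N (ind (E n)) &
                N (ind (E n)) < s n].
  elim: n => [|n [_ _ E0 _]]; first exact: GP.
  have [|? ? ? +] := GP (Num.min (N (ind (E n)) / 4) (s n.+1)).
    by rewrite lt_min s0 divr_gt0.
  by rewrite lt_min => /andP[_].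
exists E; split => n; have [mE EX E0 Es] := EP n => //; first exact: ltW.
have [|_ _ _] := GP (Num.min (N (ind (E n)) / 4) (s n.+1)).
  by rewrite lt_min s0 divr_gt0.
by rewrite lt_min => /andP[/ltW].
Qed.

(* Removing from a set the later, much smaller ones makes the sets disjoint at
   the cost of at most half of the norm. *)
Lemma exists_disjoint_sets (s : nat -> R) : (forall n, 0 < s n) ->
  exists D : nat -> set T, [/\ forall n, measurable (D n),
    forall m n x, D m x -> D n x -> m = n,
    forall n, ind (D n) \inX,
    forall n, 0 < N (ind (D n)) &
    forall n, N (ind (D n)) <= s n].
Proof.
move=> /exists_fast_sets[E [mE EX E0 Es Efast]].
pose U n := \bigcup_k E (n.+1 + k)%N.
have mU n : measurable (U n) by exact: bigcup_measurable.
pose D n := E n `\` U n.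
have mD n : measurable (D n) by exact: measurableD.
have DE n : ind (D n) \inX /\ N (ind (D n)) <= N (ind (E n)).
  apply: X_solid => //; move: (indE (mD n)) (indE (mE n)); apply: filterS2.
  move=> x -> ->; rewrite !normc_indic !indicE.
  have [[Ex Ux]|nDx] := pselect (D n x); first by rewrite !mem_set.
  by rewrite memNset.
exists D; split => // [m n x|n|n|n].
- wlog mn : m n / (m <= n)%N => [H Dm Dn|[_ Um] [En _]].
    by case/orP: (leq_total m n) => mn; [exact: H|apply/esym/H].
  move: mn; rewrite leq_eqVlt => /orP[/eqP//|mn]; exfalso; apply: Um.
  by exists (n - m.+1)%N => //; rewrite subnKC.
- exact: (DE n).1.
(* Quartering at each step is more than the halving needed here. The constant [N (ind (E n)) / 4]
   yields a dominating [F] of norm at most half of [N (ind (E n))]. *)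
- have Edecay k : N (ind (E (n.+1 + k)%N)) <= N (ind (E n)) / 4 / 2 ^+ k.
    elim: k => [|k IH]; first by rewrite addn0 expr0 divr1.
    rewrite addnS (le_trans (Efast _))// exprS invfM [2^-1 * _]mulrC mulrA.
    by have := E0 (n.+1 + k)%N; move: IH; set a := N _; set b := _ / 2 ^+ k; lra.
  have [F [FX FN FE]] := geometric_dominated X_banach X_solid (fun=> EX _) Edecay.
  (* A point of [E n] outside [D n] lies in some later set, whose indicator is at most [|F|]; as
     there are countably many later sets, one null set serves for all. *)
  have [|EDX EDN] := X_solid FX (g := ind (E n) - ind (D n)).
    have UF : \forall x \ae mu, forall k,
        normc (ind (E (n.+1 + k)%N) x) <= normc (F x).
      exact/ae_foralln.
    have UE : \forall x \ae mu, forall k,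
        ind (E (n.+1 + k)%N) x = (\1_(E (n.+1 + k)%N) x)%:C.
      by apply/ae_foralln => k; exact: indE.
    have EDn : {ae mu, forall x,
        ind (E n) x = (\1_(E n) x)%:C /\ ind (D n) x = (\1_(D n) x)%:C}.
      by move: (indE (mE n)) (indE (mD n)); apply: filterS2.
    have UFE : {ae mu, forall x, forall k,
        (\1_(E (n.+1 + k)%N) x : R) <= normc (F x)}.
      by move: UF UE; apply: filterS2 => x ? Ux k; rewrite -normc_indic -Ux.
    have := M0B (ind (E n)) (ind (D n)); move: EDn UFE; apply: filterS3.
    move=> x [Enx Dnx] UFx ->; rewrite Enx Dnx !indicE.
    have [|nEx] := pselect (E n x); last first.
      by rewrite (memNset nEx) memNset ?subrr ?normc0 ?normc_ge0// => -[].
    move=> Ex; rewrite (mem_set Ex).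
    have [[k _ Ekx]|nUx] := pselect (U n x).
      rewrite memNset; last by case=> _; apply; exists k.
      by rewrite subr0; have := UFx k; rewrite indicE mem_set// normc1.
    by rewrite mem_set// subrr normc0 normc_ge0.
  (* The removed part has at most half of the norm of [E n], so the triangle inequality leaves a
     positive norm for [D n]. *)
  have := fnormD X_banach EDX (DE n).1; rewrite subrK; have := E0 n.
  by move: EDN FN; lra.
- exact: le_trans (DE n).2 (Es n).
Qed.

(** The disjoint sets are encoded as fibres of one measurable index function, so that functions
    constant on each set become compositions with it. *)
Lemma exists_small_fibres (s : nat -> R) : (forall n, 0 < s n) ->
  exists I : T -> nat, measurable_fun setT I /\ forall n, (0 < n)%N ->
    [/\ ind (I @^-1` [set n]) \inX, 0 < N (ind (I @^-1` [set n])) &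
        N (ind (I @^-1` [set n])) <= s n].
Proof.
move=> /exists_disjoint_sets[D [mD triv DX D0 Ds]].
(* Points in no [D n] get the default index 0. The fibre over 0 thus consists of [D 0] and these
   points, and its indicator may fail to be in the space. *)
pose I x := xget 0%N [set n | D n x].
have IE n : (0 < n)%N -> I @^-1` [set n] = D n.
  move=> n0; apply/seteqP; split => x /=.
    rewrite /I; case: xgetP => [k -> /= Dk <-//|_ n00].
    by rewrite -n00 in n0.
  by move=> Dnx; rewrite /I; case: xgetP => [k _ /= Dk|/(_ n)//]; exact: triv Dk Dnx.
exists I; split => [|n n0]; last by rewrite IE.
move=> _ B _; rewrite setTI.
have -> : I @^-1` B = \bigcup_(n in B) I @^-1` [set n].
  by apply/seteqP; split => [x ?|x [n Bn /= ->]] //; exists (I x).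
apply: bigcup_measurable => -[|n] _; last by rewrite IE.
have -> : I @^-1` [set 0%N] = ~` \bigcup_n D n.+1.
  apply/seteqP; split => x /=.
    by move=> I0 [n _]; rewrite -IE//= => In; rewrite In in I0.
  move=> nD; have [//|Ix] := posnP (I x); exfalso; apply: nD.
  by exists (I x).-1 => //; rewrite prednK// -IE.
by apply: measurableC; exact: bigcup_measurable.
Qed.

End small_disjoint_sets.

(** * The spaces [Xpow X p] described through the single function [|u|^p], which is
    [abspow 1 p u] *)

Section power_space.
Context d (T : measurableType d) (R : realType).
Variable mu : {measure set T -> \bar R}.
Variable X : normed_fspace mu.
Hypothesis X_banach : banach_function_space X.
Hypothesis X_solid : solid X.
Local Notation M0 := (M0 mu).
Local Notation "u \inX" := (fcarrier X u) (at level 70).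
Local Notation N := (fnorm X).
Variable p : R.
Hypothesis p_ge1 : 1 <= p.
Implicit Types (u v : M0).

Let p_gt0 : 0 < p. Proof. exact: lt_le_trans p_ge1. Qed.

Lemma abspow1E u : {ae mu, forall x, abspow 1 p u x = (normc (u x) `^ p)%:C}.
Proof. by move: (abspowE 1 p u); apply: filterS => x ->; rewrite divr1. Qed.

(** Homogeneity moves the parameter [l] of the infimum out of the function, so that membership and
    norm bounds only concern [abspow 1 p u]. *)
Lemma abspow_scale (l : R) u : 0 < l ->
  abspow l p u = ((l `^ p)^-1)%:C *: abspow 1 p u.
Proof.
move=> l0; apply/M0P; have := M0Z ((l `^ p)^-1)%:C (abspow 1 p u).
move: (abspowE l p u) (abspow1E u); apply: filterS3 => x -> -> ->.
rewrite -rmorphM/= powRM ?normc_ge0 ?invr_ge0 ?ltW// mulrC; congr (_ * _)%:C.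
by rewrite -powR_inv1 ?ltW// -powRrM mulN1r powRN.
Qed.

Lemma abspow_le u v : {ae mu, forall x, normc (u x) <= normc (v x)} ->
  abspow 1 p v \inX ->
  abspow 1 p u \inX /\ N (abspow 1 p u) <= N (abspow 1 p v).
Proof.
move=> uv vX; apply: X_solid => //.
move: uv (abspow1E u) (abspow1E v); apply: filterS3 => x uvx -> ->.
rewrite !normc_real !ger0_norm ?powR_ge0//.
by rewrite ge0_ler_powR ?nnegrE ?normc_ge0// ltW.
Qed.

Lemma abspowZ a u : abspow 1 p (a *: u) = (normc a `^ p)%:C *: abspow 1 p u.
Proof.
apply/M0P; have := M0Z (normc a `^ p)%:C (abspow 1 p u).
have := M0Z a u; move=> A B.
move: A B (abspow1E (a *: u)) (abspow1E u) => A B C D.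
near=> x; rewrite (near B x)// (near C x)// (near D x)// (near A x)//.
by rewrite normcM powRM ?normc_ge0// rmorphM.
Unshelve. all: by end_near. Qed.

Lemma carrier_abspowZ a u : abspow 1 p u \inX -> abspow 1 p (a *: u) \inX.
Proof. by rewrite abspowZ; exact: carrierZ. Qed.

Lemma fnorm_abspowZ a u : abspow 1 p u \inX ->
  N (abspow 1 p (a *: u)) = normc a `^ p * N (abspow 1 p u).
Proof.
by move=> uX; rewrite abspowZ (fnormZ X_banach)// normc_real ger0_norm// powR_ge0.
Qed.

(** Pointwise, [|a + b|^p <= (2 max(|a|, |b|))^p <= 2^p (|a|^p + |b|^p)]. This quasi-triangle
    inequality stands in for the one of the norm of [Xpow X p] in the limit arguments. *)
Lemma abspowD u v : abspow 1 p u \inX -> abspow 1 p v \inX ->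
  abspow 1 p (u + v) \inX /\
  N (abspow 1 p (u + v)) <= 2 `^ p * (N (abspow 1 p u) + N (abspow 1 p v)).
Proof.
move=> uX vX; set c : R := 2 `^ p.
have c0 : 0 <= c by exact: powR_ge0.
have sX := carrierD X_banach uX vX.
pose w := c%:C *: (abspow 1 p u + abspow 1 p v).
have wX : w \inX by exact: carrierZ.
have [|uvX uvN] := X_solid wX (g := abspow 1 p (u + v)).
  have W := M0Z c%:C (abspow 1 p u + abspow 1 p v).
  have V := M0D (abspow 1 p u) (abspow 1 p v).
  have A := abspow1E u; have B := abspow1E v; have C := abspow1E (u + v).
  have D := M0D u v.
  near=> x; rewrite /w (near W x)// (near V x)// (near A x)// (near B x)//.
  rewrite (near C x)// (near D x)// -rmorphD -rmorphM !normc_real.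
  rewrite !ger0_norm ?mulr_ge0 ?addr_ge0 ?powR_ge0//.
  set a := u x; set b := v x.
  have m0 : 0 <= Num.max (normc a) (normc b) by rewrite le_max normc_ge0.
  apply: (@le_trans _ _ ((2 * Num.max (normc a) (normc b)) `^ p)).
    rewrite ge0_ler_powR ?nnegrE ?normc_ge0 ?mulr_ge0 ?(ltW p_gt0)//.
    by rewrite (le_trans (le_normcD _ _))// mulr_natl lerD// le_max lexx ?orbT.
  rewrite powRM// ler_wpM2l//; case: (leP (normc a)) => _.
    by rewrite lerDr powR_ge0.
  by rewrite lerDl powR_ge0.
split => //; apply: le_trans uvN _.
rewrite (fnormZ X_banach)// normc_real ger0_norm// ler_wpM2l//.
exact: fnormD.
Unshelve. all: by end_near. Qed.

Lemma abspow_eq0 u : abspow 1 p u = 0 -> u = 0.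
Proof.
move=> /M0P u0; apply/M0P; move: u0 (abspow1E u) (M00 mu).
by apply: filterS3 => x -> + z0; rewrite z0 => -[/esym/powR_eq0_eq0/eq0_normc].
Qed.

Lemma abspow0 : abspow 1 p (0 : M0) = 0.
Proof.
apply/M0P; move: (abspow1E 0) (M00 mu); apply: filterS2 => x -> ->.
by rewrite normc0 powR0// gt_eqF.
Qed.

(** One admissible [l] suffices to rescale to [l = 1]. Conversely [l = N (abspow 1 p u) + 1] is
    admissible: adding 1 gives [1 <= l], hence [l <= l^p]. *)
Lemma XpowP u : fcarrier (Xpow X p) u <-> abspow 1 p u \inX.
Proof.
split=> [/ereal_inf_lt[_ [l [l0 lX _] _] _]|uX].
  have /(carrierZ X_banach (l `^ p)%:C) := lX; rewrite abspow_scale// scalerA.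
  by rewrite -rmorphM divff ?scale1r// gt_eqF// powR_gt0.
have N0 := fnorm_ge0 X_banach uX.
pose l := N (abspow 1 p u) + 1.
have l1 : 1 <= l by rewrite lerDr.
have l0 : 0 < l by exact: lt_le_trans l1.
apply: (@le_lt_trans _ _ l%:E); last exact: ltry.
apply: ereal_inf_lbound; exists l => //=; rewrite abspow_scale//; split => //.
  exact: carrierZ.
rewrite (fnormZ X_banach)// normc_real ger0_norm ?invr_ge0 ?powR_ge0//.
rewrite ler_pdivrMl ?powR_gt0// mulr1 (le_trans _ (le1r_powR l1 p_ge1))//.
by rewrite lerDl.
Qed.

(** An infimum below [e] provides an admissible [l < e], for which [N (abspow 1 p u) <= l^p].
    Membership of [u] makes the infimum finite, so that [fine] returns its true value. *)
Lemma Xpow_norm_lt u e : fcarrier (Xpow X p) u -> fnorm (Xpow X p) u < e ->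
  N (abspow 1 p u) <= e `^ p.
Proof.
move=> uX ue.
have n0 : (0 <= Xpow_norm X p u)%E.
  by apply: le_ereal_inf_tmp => _ [l [l0 _ _] <-]; rewrite lee_fin ltW.
have : (Xpow_norm X p u < e%:E)%E.
  by move: ue; rewrite -lte_fin /= fineK// ge0_fin_numE.
move=> /ereal_inf_lt[_ [l [l0 lX l1] <-]]; rewrite lte_fin => le.
have uX1 := (XpowP u).1 uX.
move: l1; rewrite abspow_scale// (fnormZ X_banach)// normc_real.
rewrite ger0_norm ?invr_ge0 ?powR_ge0//.
rewrite ler_pdivrMl ?powR_gt0// mulr1 => /le_trans; apply.
by rewrite ge0_ler_powR ?nnegrE// ?ltW// (lt_trans l0).
Qed.

End power_space.

(** * Restrictions to the fibres of a measurable index function *)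

Section pieces.
Context d (T : measurableType d) (R : realType).
Variable mu : {measure set T -> \bar R}.
Local Notation M0 := (M0 mu).
Variable J : T -> nat.
Hypothesis mJ : measurable_fun setT J.
Implicit Types (u v : M0) (j k : nat).

Definition piece j u : M0 := toM0 mu (fun x => if J x == j then u x else 0).

Lemma pieceE j u : {ae mu, forall x, piece j u x = if J x == j then u x else 0}.
Proof.
apply: toM0E; apply: measurable_fun_ifT; last 2 first.
- exact: M0_measurable.
- exact: measurable_cst.
- exact: (measurableT_comp (f := fun n => n == j)).
Qed.

Lemma pieceD j u v : piece j (u + v) = piece j u + piece j v.
Proof.
apply/M0P; have A := M0D (piece j u) (piece j v); have B := M0D u v.
have C := pieceE j u; have D := pieceE j v; have E := pieceE j (u + v).
near=> x; rewrite (near A x)// (near E x)// (near C x)// (near D x)//.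
by rewrite (near B x)//; case: ifP; rewrite ?addr0.
Unshelve. all: by end_near. Qed.

Lemma pieceZ j a u : piece j (a *: u) = a *: piece j u.
Proof.
apply/M0P; have A := M0Z a (piece j u); have B := M0Z a u.
have C := pieceE j u; have D := pieceE j (a *: u).
near=> x; rewrite (near A x)// (near D x)// (near C x)// (near B x)//.
by case: ifP; rewrite ?mulr0.
Unshelve. all: by end_near. Qed.

Lemma piece0 j : piece j 0 = 0.
Proof. by have := pieceZ j 0 0; rewrite !scale0r. Qed.

Lemma pieceB j u v : piece j (u - v) = piece j u - piece j v.
Proof. by rewrite pieceD -scaleN1r pieceZ scaleN1r. Qed.

Lemma piece_sum j (I : Type) (r : seq I) (F : I -> M0) :
  piece j (\sum_(i <- r) F i) = \sum_(i <- r) piece j (F i).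
Proof. by apply: (big_morph (piece j)); [exact: pieceD|exact: piece0]. Qed.

Lemma piece_piece j k u : piece j (piece k u) = if k == j then piece j u else 0.
Proof.
case: eqVneq => [->|kj] /=; apply/M0P.
  move: (pieceE j u) (pieceE j (piece j u)); apply: filterS2 => x -> ->.
  by case: (J x == j).
move: (pieceE k u) (pieceE j (piece k u)) (M00 mu).
apply: filterS3 => x kE jE zE; rewrite jE kE zE; case: ifP => // /eqP ->.
by rewrite eq_sym (negbTE kj).
Qed.

Lemma le_piece j u : {ae mu, forall x, normc (piece j u x) <= normc (u x)}.
Proof.
by move: (pieceE j u); apply: filterS => x ->; case: ifP; rewrite ?normc0 ?normc_ge0.
Qed.

(** Countably many almost everywhere statements hold at once, and at [x] the one with [j = J x]
    gives the value of [u]. *)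
Lemma piece_eq0 u : (forall j, piece j u = 0) -> u = 0.
Proof.
move=> u0; apply/M0P.
have A : {ae mu, forall x, forall j, piece j u x = if J x == j then u x else 0}.
  by apply: ae_foralln => j; exact: pieceE.
have B : {ae mu, forall x, forall j, piece j u x = (0 : M0) x}.
  by apply: ae_foralln => j; rewrite u0; exact: aeW.
by move: A B; apply: filterS2 => x /(_ (J x)) + /(_ (J x)) => ->; rewrite eqxx.
Qed.

End pieces.

(** * The subspace of functions proportional to [h] on each fibre *)

Section spaceability_criterion.
Context d (T : measurableType d) (R : realType).
Variable mu : {measure set T -> \bar R}.
Variable X : normed_fspace mu.
Hypothesis X_banach : banach_function_space X.
Hypothesis X_solid : solid X.
Local Notation M0 := (M0 mu).
Local Notation "u \inX" := (fcarrier X u) (at level 70).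
Variable p : R.
Hypothesis p_ge1 : 1 <= p.
Variable J : T -> nat.
Hypothesis mJ : measurable_fun setT J.
Variable h : M0.
Hypothesis hX : abspow 1 p h \inX.
Hypothesis h_notin : forall j q, p < q -> ~ (abspow 1 q (piece J j h) \inX).
Local Notation N u := (fnorm X (abspow 1 p u)).
Implicit Types (u v : M0) (j k : nat).

Definition proportional : set M0 := [set u | fcarrier (Xpow X p) u /\
  forall j, exists c : R[i], piece J j u = c *: piece J j h].

Let inXp u : fcarrier (Xpow X p) u <-> abspow 1 p u \inX := XpowP X_banach p_ge1 u.

Let inX_piece j u : abspow 1 p u \inX ->
  abspow 1 p (piece J j u) \inX /\ N (piece J j u) <= N u.
Proof. by move=> uX; apply: abspow_le => //; exact: le_piece. Qed.

Let inX_B u v : abspow 1 p u \inX -> abspow 1 p v \inX ->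
  abspow 1 p (u - v) \inX.
Proof.
move=> uX vX; rewrite -scaleN1r; apply: (abspowD X_banach X_solid p_ge1 uX _).1.
exact: carrier_abspowZ.
Qed.

Lemma fnorm_abspowBC u v : N (u - v) = N (v - u).
Proof. by rewrite -opprB -scaleN1r abspowZ normcN normc1 powR1 scale1r. Qed.

(** The zero function lies in every power space, so a vanishing piece would contradict [h_notin];
    any exponent above [p] would do. *)
Lemma piece_neq0 j : piece J j h != 0.
Proof.
apply/eqP => h0; apply: (@h_notin j (p + 1)); first by rewrite ltrDl.
have p1 : 1 <= p + 1 by rewrite (le_trans p_ge1)// lerDl.
by rewrite h0 abspow0//; exact: carrier0.
Qed.

Lemma proportional_submod : submod_closed (mem proportional).
Proof.
split; first (apply/mem_set; split).
- by apply/inXp; rewrite abspow0//; exact: carrier0.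
- by move=> j; exists 0; rewrite piece0// scale0r.
- move=> a u v /set_mem[/inXp uX uc] /set_mem[/inXp vX vc]; apply/mem_set; split.
    apply/inXp; apply: (abspowD X_banach X_solid p_ge1 _ vX).1.
    exact: carrier_abspowZ.
  move=> j; have [[c cE] [b bE]] := (uc j, vc j); exists (a * c + b).
  by rewrite pieceD// pieceZ// cE bE scalerA scalerDl.
Qed.

Lemma proportional_piece k : proportional (piece J k h).
Proof.
split; first by apply/inXp; exact: (inX_piece k hX).1.
move=> j; rewrite piece_piece//; case: eqP => _; first by exists 1; rewrite scale1r.
by exists 0; rewrite scale0r.
Qed.

(** If [n] vectors spanned, [n + 1] pieces of [h] would expand in them with coefficients [A], and
    their own pieces are multiples [B] of those of [h]. Taking pieces again gives [A B = 1] in size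
    [n + 1], which factors the identity through dimension [n]. *)
Lemma proportional_infinite_dim : ~ finite_dimensional proportional.
Proof.
move=> [n [b [bV span]]].
have /choice[A AE] (k : 'I_n.+1) : exists c : 'I_n -> R[i],
    piece J k h = \sum_(i < n) c i *: b i.
  exact: span (proportional_piece k).
have /choice[B BE] (i : 'I_n) : exists c : nat -> R[i], forall k,
    piece J k (b i) = c k *: piece J k h.
  by have /choice[c cE] := (bV i).2; exists c.
suff /mulmx1_min : (\matrix_(k < n.+1, i < n) A k i) *m
    (\matrix_(i < n, l < n.+1) B i l) = 1%:M by rewrite ltnn.
apply/matrixP => k l; rewrite !mxE; under eq_bigr do rewrite !mxE.
apply/eqP; rewrite -subr_eq0.
suff : (\sum_i A k i * B i l - (k == l)%:R) *: piece J l h == 0.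
  by rewrite scaler_eq0 (negbTE (piece_neq0 l)) orbF.
rewrite scalerBl scaler_suml subr_eq0; apply/eqP.
transitivity (piece J l (piece J k h)).
  rewrite [in RHS]AE piece_sum//; apply: eq_bigr => i _.
  by rewrite pieceZ// BE scalerA.
rewrite piece_piece// -[in RHS]val_eqE/=.
by case: eqP => _; rewrite ?scale1r ?scale0r.
Qed.

(** The coefficients of approximants [g n] of [f] on a fibre form a Cauchy sequence, because the
    piece of [h] there has positive norm; their limit is the coefficient of [f]. *)
Lemma proportional_closed : closed_in (Xpow X p) proportional.
Proof.
move=> f fXp happrox; split=> // j; set hj := piece J j h.
have fX := (inXp f).1 fXp.
have [hjX _] := inX_piece j hX.
have hj0 : 0 < N hj.
  apply: (fnorm_gt0 X_banach) => //; have := piece_neq0 j; apply: contra_neq.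
  exact: abspow_eq0.
set K : R := 2 `^ p; have K0 : 0 < K by exact: powR_gt0.
have /choice[g gP] (n : nat) : exists g, proportional g /\ N (f - g) <= n.+1%:R^-1.
  have [|g gV gf] := happrox n.+1%:R^-1; first by rewrite invr_gt0.
  exists g; split => //; have gX := (inXp g).1 gV.1.
  apply: (le_trans (Xpow_norm_lt X_banach p_ge1 _ gf)).
    exact/inXp/inX_B.
  by rewrite ge1r_powR// invr_gt0 ltr0n/= invf_le1// ler1n.
have gX n : abspow 1 p (g n) \inX by apply/inXp; exact: (gP n).1.1.
have /choice[c cE] n : exists c : R[i], piece J j (g n) = c *: hj.
  exact: (gP n).1.2.
have NfgX n := inX_B fX (gX n).
have Nfg n : N (piece J j (f - g n)) <= n.+1%:R^-1.
  exact: le_trans (inX_piece j (NfgX n)).2 (gP n).2.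
have [l cl] : exists l, normc (c n - l) @[n --> \oo] --> (0 : R).
  apply: normc_cauchy_cvg => e e0.
  (* Threshold at which two errors below it, multiplied by [K], add up to less than [e^p * N hj]; a
     gap of at least [e] between coefficients is then impossible. *)
  have D0 : 0 < e `^ p * N hj / (2 * K) by rewrite divr_gt0 ?mulr_gt0 ?powR_gt0.
  have [M _ MP] := near_infty_natSinv_lt (PosNum D0).
  exists M => m n Mm Mn; rewrite ltNge; apply/negP => ecmn.
  have : e `^ p * N hj <= K * (N (piece J j (f - g n)) + N (piece J j (f - g m))).
    apply: (@le_trans _ _ (N ((c m - c n) *: hj))).
      rewrite (fnorm_abspowZ X_banach)// ler_wpM2r ?(ltW hj0)//.
      by rewrite ge0_ler_powR ?nnegrE ?normc_ge0 ?(ltW e0)// (le_trans _ p_ge1).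
    rewrite scalerBl -!cE.
    have -> : piece J j (g m) - piece J j (g n) =
        piece J j (f - g n) + piece J j (g m - f).
      by rewrite -pieceD// -pieceB// [f - _ + _]addrC subrKA.
    rewrite [in leRHS](_ : N (piece J j (f - g m)) = N (piece J j (g m - f))).
      apply: (abspowD X_banach X_solid p_ge1 _ _).2.
        exact: (inX_piece j (NfgX n)).1.
      by apply: (inX_piece j _).1; exact: inX_B.
    by rewrite !pieceB// fnorm_abspowBC.
  apply/negP; rewrite -ltNge.
  have := le_lt_trans (Nfg n) (MP n Mn); have := le_lt_trans (Nfg m) (MP m Mm).
  rewrite /= !ltr_pdivlMr ?mulr_gt0//.
  set a := N _; set b := N (piece J j (f - g n)); set E := e `^ p * _; lra.
exists l; apply/eqP; rewrite -subr_eq0; apply/eqP.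
have pfX := (inX_piece j fX).1.
have lX : abspow 1 p (l *: hj) \inX by exact: carrier_abspowZ.
apply: (@abspow_eq0 _ _ _ _ p); apply: (fnorm_eq0 X_banach); first exact: inX_B.
apply/eqP; rewrite eq_le (fnorm_ge0 X_banach) ?andbT; last exact: inX_B.
apply/ler_addgt0Pr => e e0; rewrite add0r.
(* Both the error of [g n] and [normc (c n - l) ^ p] will be at most [r], for a total of at most
   [r * B <= e]. The minimum with 1 in [r] ensures [r^p <= r]. *)
pose B := K * (1 + N hj).
have B0 : 0 < B by rewrite mulr_gt0// addr_gt0.
pose r := Num.min 1 (e / B).
have r0 : 0 < r by rewrite lt_min ltr01 divr_gt0.
have [M1 _ M1P] := near_infty_natSinv_lt (PosNum r0).
have /cvgrPdist_lt/(_ _ r0)[M2 _ M2P] := cl.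
pose n := maxn M1 M2.
have /= nr := M1P n (leq_maxl _ _).
have /= := M2P n (leq_maxr _ _); rewrite sub0r normrN ger0_norm ?normc_ge0// => cr.
have -> : piece J j f - l *: hj = piece J j (f - g n) + (c n - l) *: hj.
  by rewrite pieceB// cE scalerBl addrA subrK.
apply: (le_trans (abspowD X_banach X_solid p_ge1 _ _).2).
- exact: (inX_piece j (NfgX n)).1.
- exact: carrier_abspowZ.
rewrite (fnorm_abspowZ X_banach)//.
have cr' : normc (c n - l) `^ p <= r.
  have r1 : 0 < r <= 1 by rewrite r0/= ge_min lexx.
  rewrite (le_trans _ (ge1r_powR r1 p_ge1))//.
  by rewrite ge0_ler_powR ?nnegrE ?normc_ge0 ?(ltW r0) ?(ltW cr)// (le_trans _ p_ge1).
apply: (@le_trans _ _ (r * B)).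
  rewrite /B mulrCA ler_wpM2l ?(ltW K0)// mulrDr mulr1 lerD//.
    by rewrite (le_trans (Nfg n))// ltW.
  by rewrite ler_wpM2r// ltW.
by rewrite -ler_pdivlMr// ge_min lexx orbT.
Qed.

Lemma proportional_notin_larger_power u q :
  proportional u -> u != 0 -> p < q -> ~ fcarrier (Xpow X q) u.
Proof.
move=> [_ uc] u0 pq.
have q_ge1 : 1 <= q by rewrite (le_trans p_ge1)// ltW.
move=> /(XpowP X_banach q_ge1) uX.
have [j uj] : exists j, piece J j u != 0.
  apply: contrapT => H; move/eqP: u0; apply; apply: (piece_eq0 mJ) => j.
  by apply: contrapT => /eqP uj; apply: H; exists j.
have [c cE] := uc j; apply: (h_notin pq (j := j)).
have c0 : c != 0 by apply: contra_neq uj => c0; rewrite cE c0 scale0r.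
have -> : piece J j h = c^-1 *: piece J j u by rewrite cE scalerA mulVf// scale1r.
apply: carrier_abspowZ => //.
by apply: (abspow_le X_solid q_ge1 _ uX).1; exact: le_piece.
Qed.

Lemma spaceable_criterion :
  spaceable (fcarrier (Xpow X p) `\`
             \bigcup_(q in [set q : R | p < q]) fcarrier (Xpow X q))
    (Xpow X p).
Proof.
exists proportional; split.
- by move=> u [].
- exact: proportional_submod.
- exact: proportional_closed.
- exact: proportional_infinite_dim.
- move=> u uV; have [->|u0] := eqVneq u 0; [by right|left; split; first exact: uV.1].
  by move=> [q pq]; exact: proportional_notin_larger_power.
Qed.

End spaceability_criterion.

(** * A function in the [p]-th power space whose pieces lie in no larger power space *)

Section spiky_function.
Context d (T : measurableType d) (R : realType).
Variable mu : {measure set T -> \bar R}.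
Variable X : normed_fspace mu.
Hypothesis X_banach : banach_function_space X.
Hypothesis X_solid : solid X.
Local Notation "u \inX" := (fcarrier X u) (at level 70).
Variable p : R.
Hypothesis p_ge1 : 1 <= p.

(** This is [2^(-n^2 - n)]. One factor [2^-n] is absorbed in the weight, which is therefore at least
    [2^(n^2)]; every positive power of it eventually outgrows [2^n]. *)
Let s (n : nat) : R := (2 ^+ n * (2 ^+ n) ^+ n)^-1.

Variable I : T -> nat.
Hypothesis mI : measurable_fun setT I.
Local Notation fib n := (ind mu (I @^-1` [set n])).
Local Notation del n := (fnorm X (fib n)).
Hypothesis fibP : forall n, (0 < n)%N ->
  [/\ fib n \inX, 0 < del n & del n <= s n].

(* The weight for which [weight n *: chi] has norm [2^-n] on the n-th fibre;
   the fibre over 0 may fail to lie in X and is given weight 0. *)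
Let weight (n : nat) : R := if n == 0%N then 0 else (2 ^+ n * del n)^-1.

Let weight_ge0 n : 0 <= weight n.
Proof.
rewrite /weight; case: eqVneq => // n0.
have [_ ? _] := fibP (etrans (lt0n n) n0).
by rewrite invr_ge0 mulr_ge0 ?ltW// exprn_gt0.
Qed.

Let weight_del n : (0 < n)%N -> weight n * del n = 2 ^- n.
Proof.
move=> n0; rewrite /weight gtn_eqF//; have [_ d0 _] := fibP n0.
by rewrite invfM mulfVK// gt_eqF.
Qed.

Let weight_ge n : (0 < n)%N -> (2 ^+ n) ^+ n <= weight n.
Proof.
move=> n0; rewrite /weight gtn_eqF//; have [_ d0 ds] := fibP n0.
rewrite -[leLHS]invrK lef_pV2 ?posrE ?invr_gt0 ?mulr_gt0 ?exprn_gt0//.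
by rewrite -ler_pdivlMl ?exprn_gt0// -invfM.
Qed.

Definition spiky : M0 mu := toM0 mu (fun x => (weight (I x) `^ p^-1)%:C).

Lemma spikyE : {ae mu, forall x, spiky x = (weight (I x) `^ p^-1)%:C}.
Proof.
apply/toM0E/measurable_real_complex.
exact: (measurableT_comp (f := fun n => weight n `^ p^-1)).
Qed.

Let mfib n : measurable (I @^-1` [set n]).
Proof. by have := mI measurableT (Y := [set n]); rewrite setTI; apply. Qed.

(** The [p]-th power of the function is the weight, equal on the [n]-th fibre to a multiple of its
    indicator of norm [2^-n]; [geometric_dominated] with constant 1 and solidity conclude. *)
Lemma spiky_power_in : abspow 1 p spiky \inX.
Proof.
have p0 : 0 < p by exact: lt_le_trans p_ge1.
pose u n : M0 mu := if n == 0%N then 0 else (weight n)%:C *: fib n.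
have uX n : u n \inX.
  rewrite /u; case: eqVneq => [_|n0]; first exact: carrier0.
  by apply: carrierZ => //; have [] := fibP (etrans (lt0n n) n0).
have uN n : fnorm X (u n) <= 1 / 2 ^+ n.
  rewrite /u; case: eqVneq => [->|n0].
    by rewrite (fnorm0 X_banach) expr0 divr1.
  have n_gt0 := etrans (lt0n n) n0; have [fX _ _] := fibP n_gt0.
  rewrite (fnormZ X_banach)// normc_real ger0_norm ?weight_ge0//.
  by rewrite weight_del// div1r.
have [F [FX _ uF]] := geometric_dominated X_banach X_solid uX uN.
apply: (X_solid FX _).1.
have A : {ae mu, forall x, forall n, normc (u n x) <= normc (F x)}.
  exact: ae_foralln.
have B : {ae mu, forall x, forall n, (0 < n)%N ->
    u n x = (weight n * \1_(I @^-1` [set n]) x)%:C}.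
  apply: ae_foralln => n; rewrite /u; case: eqVneq => [->|n0]; first exact: aeW.
  have := M0Z (weight n)%:C (fib n); move: (indE mu (mfib n)).
  by apply: filterS2 => x -> -> _; rewrite rmorphM.
have C := abspow1E p spiky; have D := spikyE.
near=> x; rewrite (near C x)// (near D x)// !normc_real !ger0_norm ?powR_ge0//.
rewrite -powRrM mulVf ?gt_eqF// powRr1 ?weight_ge0//.
have [I0|I0] := posnP (I x); first by rewrite I0 /weight eqxx normc_ge0.
apply: le_trans (near A x _ (I x)) => //.
rewrite (near B x)// indicE mem_set// mulr1 normc_real ger0_norm.
Unshelve. all: by end_near. Qed.

(** With [r = q / p > 1], the fibre over [n] contributes [weight^r * del = weight^(r-1) * 2^-n >=
    2^(n^2 (r-1) - n)]. This is at least [2^n] once [n (r-1) >= 2], and such [n] of valuation [j]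
    are arbitrarily large. *)
Lemma spiky_power_notin j q : p < q ->
  ~ (abspow 1 q (piece (fun x => logn 2 (I x)) j spiky) \inX).
Proof.
set J := fun x => logn 2 (I x); move=> pq.
have p0 : 0 < p by exact: lt_le_trans p_ge1.
have q0 : 0 < q by exact: lt_trans pq.
set v := abspow _ _ _ => vX; set M := fnorm X v.
have M_ge0 : 0 <= M by exact: fnorm_ge0.
set r := p^-1 * q; have r1 : 0 < r - 1 by rewrite subr_gt0 /r ltr_pdivlMl// mulr1.
have mJ : measurable_fun setT J by exact: (measurableT_comp (f := logn 2)).
have main n : (0 < n)%N -> logn 2 n = j -> weight n `^ r * del n <= M.
  move=> n0 nj; have [fX _ _] := fibP n0.
  have [|_] := X_solid vX (g := (weight n `^ r)%:C *: fib n).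
    have A := M0Z (weight n `^ r)%:C (fib n); have B := indE mu (mfib n).
    have C := abspow1E q (piece J j spiky).
    have D := pieceE mJ j spiky; have E := spikyE.
    near=> x; rewrite (near A x)// (near B x)// (near C x)// (near D x)//.
    rewrite (near E x)//.
    rewrite -rmorphM !normc_real indicE.
    have [Ix|Ix] := pselect (I x = n); last by rewrite memNset// mulr0 normr0.
    rewrite mem_set// mulr1 /J Ix nj eqxx normc_real.
    by rewrite (ger0_norm (powR_ge0 _ p^-1)) -powRrM.
  by rewrite (fnormZ X_banach)// normc_real ger0_norm ?powR_ge0.
have big n : (0 < n)%N -> logn 2 n = j -> 2 <= n%:R * (r - 1) -> n%:R <= M.
  move=> n0 nj n2; apply: le_trans (main n n0 nj).
  have w0 : 0 < weight n by apply: lt_le_trans (weight_ge n0); rewrite !exprn_gt0.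
  have -> : weight n `^ r = weight n `^ (r - 1) * weight n.
    by rewrite mulrC mulr_powRB1 ?ltW// (lt_trans ltr01)// -subr_gt0.
  rewrite -mulrA weight_del// ler_pdivlMr ?exprn_gt0//.
  apply: (@le_trans _ _ ((2 ^+ n) ^+ 2)).
    rewrite expr2 ler_wpM2r ?exprn_ge0// -natrX ler_nat ltnW//.
    exact: ltn_expl.
  apply: (@le_trans _ _ (((2 ^+ n) ^+ n) `^ (r - 1))); last first.
    by rewrite ge0_ler_powR ?nnegrE ?exprn_ge0 ?weight_ge0 ?weight_ge ?ltW.
  have a1 : 1 <= 2 ^+ n :> R by rewrite exprn_ege1// ler1n.
  have a0 := le_trans ler01 a1.
  by rewrite -(powR_mulrn 2 a0) -(powR_mulrn n a0) -powRrM ler_powR.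
(* [k] exceeds both [M] and [2 / (r - 1)]. Multiplying the odd number [2k + 1] by [2^j] gives an
   index at least [k] with 2-adic valuation exactly [j]. *)
pose k := Num.bound (M + 2 / (r - 1)).
have kM : M + 2 / (r - 1) < k%:R.
  by rewrite archi_boundP// addr_ge0// divr_ge0// ltW.
pose n := (k.*2.+1 * 2 ^ j)%N.
have kn : (k%:R : R) <= n%:R.
  rewrite ler_nat /n (@leq_trans (k.*2.+1))//; last by rewrite leq_pmulr// expn_gt0.
  by rewrite -addnn -addnS leq_addr.
have r2 : 0 <= 2 / (r - 1) by rewrite divr_ge0// ltW.
have n0 : (0 < n)%N by rewrite muln_gt0 expn_gt0.
have nj : logn 2 n = j.
  by rewrite logn_Gauss ?pfactorK// coprime2n /= odd_double.
have := big n n0 nj; rewrite -ler_pdivrMr// => H.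
have [|] := ltP M n%:R; last by move: kM kn; lra.
by rewrite ltNge H//; move: kM kn; lra.
Unshelve. all: by end_near. Qed.

End spiky_function.

Theorem theorem3p4 (R : realType) (d : measure_display) (T : measurableType d)
  (mu : {sigma_finite_measure set T -> \bar R}) (X : normed_fspace mu)
  (X_banach : banach_function_space X) (X_solid : solid X)
  (inf_A_zero : ereal_inf [set (fnorm X (chi mu E))%:E | E in A_zero X] = 0%E)
  (sup_A_infty :
    (ereal_sup [set (fnorm X (chi mu E))%:E | E in A_infty X] < +oo)%E)
  (p : R) (p_ge1 : 1 <= p) :
  spaceable (fcarrier (Xpow X p) `\`
             \bigcup_(q in [set q : R | p < q]) fcarrier (Xpow X q))
    (Xpow X p).
Proof.
have [|I [mI fibP]] := exists_small_fibres X_banach X_solid inf_A_zero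
    (s := fun n => (2 ^+ n * (2 ^+ n) ^+ n)^-1).
  by move=> n; rewrite invr_gt0 mulr_gt0 ?exprn_gt0.
(* The 2-adic valuation splits the positive indices into infinitely many infinite classes. Index 0
   joins class 0, harmlessly since its weight is 0. *)
apply: (@spaceable_criterion _ _ _ _ _ X_banach X_solid _ p_ge1
  (logn 2 \o I) _ (spiky X p I)).
- exact: (measurableT_comp (f := logn 2)).
- exact: spiky_power_in.
- by move=> j q pq; exact: spiky_power_notin.
Qed.
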